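(* Let $A=\mathbb{C}[y_1,\dots,y_n,x_1,\dots,x_p]$ and let $f_1,\dots,f_s\in A$ be such that $f_1=-m+\sum_{i=1}^n y_i$ for some nonzero $m\in\mathbb{N}$, the polynomials $y_i^2-y_i$ ($i\in[n]$) are among $f_2,\dots,f_s$, and the system $f_1=\dots=f_s=0$ has no common zero in $\mathbb{C}^{n+p}$. Assume that $R=A/\langle f_2,\dots,f_s\rangle$ is Artinian and that the system $f_2=\dots=f_s=0$ is subset closed. Then there is a Nullstellensatz certificate $\beta_1,\dots,\beta_s$ for the system $f_1=0,\dots,f_s=0$ such that the monomials of $\beta_1$ with non-zero coefficient are precisely the monomials $y_{\mathbf b}$ for $\mathbf b\in B$.
   Context: A Nullstellensatz certificate for $f_1,\dots,f_s$ is a tuple of polynomials $\beta_1,\dots,\beta_s\in A$ with $\sum_{i=1}^s\beta_if_i=1$; its degree is $\max_i\deg\beta_i$. The variables $y_1,\dots,y_n$ are called indicator variables. For $\mathbf d=(d_1,\dots,d_n)\in\{0,1\}^n$ write $y_{\mathbf d}=\prod_{i:\,d_i=1}y_i$. Let $B\subseteq\{0,1\}^n$ be the set of $\mathbf d$ such that some common zero of $f_2,\dots,f_s$ in $\mathbb{C}^{n+p}$ has $y_i=d_i$ for all $i$. For $I\subseteq[n]$ let $\chi_I(i)=1$ if $i\in I$ and $0$ otherwise. The system $f_2=\dots=f_s=0$ is subset closed if (a) it has a solution with $y_1=\dots=y_n=0$, and (b) whenever it has a solution with $y_i=\chi_I(i)$ for all $i$, then for every $J\subseteq I$ it has a solution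 with $y_j=\chi_J(j)$ for all $j$. *)

(* Defs.v *)
From HB Require Import structures.
From mathcomp Require Import all_boot all_order all_algebra.
From mathcomp Require Import boolp classical_sets reals.
From mathcomp Require Import complex.
From mathcomp Require Import mpoly.

Set Implicit Arguments.
Unset Strict Implicit.
Unset Printing Implicit Defensive.

Import GRing.Theory.

Local Open Scope ring_scope.
Local Open Scope quotient_scope.

Section GeneratedIdeal.
Variables (A : comNzRingType) (s : nat) (f : 'I_s -> A).

Definition ideal_gen : {pred A} :=
  fun x => `[< exists g : 'I_s -> A, x = \sum_i g i * f i >].

Lemma ideal_genP x :
  reflect (exists g : 'I_s -> A, x = \sum_i g i * f i) (x \in ideal_gen).
Proof. exact: asboolP. Qed.

Lemma ideal_gen_zmod_closed : zmod_closed ideal_gen.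
Proof.
split; first by apply/ideal_genP; exists (fun=> 0); rewrite big1 // => i _; rewrite mul0r.
move=> x y /ideal_genP[g ->] /ideal_genP[h ->]; apply/ideal_genP.
exists (fun i => g i - h i); rewrite -sumrB.
by apply: eq_bigr => i _; rewrite mulrBl.
Qed.

Lemma ideal_genMr a x : x \in ideal_gen -> a * x \in ideal_gen.
Proof.
move=> /ideal_genP[g ->]; apply/ideal_genP; exists (fun i => a * g i).
by rewrite mulr_sumr; apply: eq_bigr => i _; rewrite mulrA.
Qed.

HB.instance Definition _ := GRing.isZmodClosed.Build A ideal_gen
  ideal_gen_zmod_closed.

(* [{ideal_quot _}] only carries a ring structure for ideals known to be
   proper; the multiplication below makes the quotient by an arbitrary
   finitely generated ideal a (possibly zero) commutative ring. *)
Definition quot_ring := {ideal_quot ideal_gen}.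

HB.instance Definition _ : EqQuotient A (Quotient.equiv ideal_gen) quot_ring :=
  EqQuotient.on quot_ring.
HB.instance Definition _ := GRing.Zmodule.on quot_ring.

Definition quot_one : quot_ring := \pi_quot_ring 1.
Definition quot_mul : quot_ring -> quot_ring -> quot_ring :=
  lift_op2 quot_ring *%R.

Lemma quot_ring_eqE (x y : A) :
  (\pi_quot_ring x == \pi_quot_ring y) = (x - y \in ideal_gen).
Proof. by rewrite -Quotient.idealrBE. Qed.

Lemma pi_quot_mul x y :
  \pi_quot_ring (x * y) = quot_mul (\pi_quot_ring x) (\pi_quot_ring y).
Proof.
apply/eqP; rewrite /quot_mul; unlock; rewrite quot_ring_eqE.
set x' := repr _; set y' := repr _.
have hx : x - x' \in ideal_gen by rewrite -quot_ring_eqE reprK.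
have hy : y - y' \in ideal_gen by rewrite -quot_ring_eqE reprK.
have -> : x * y - x' * y' = y * (x - x') + x' * (y - y').
  by rewrite !mulrBr (mulrC y x) (mulrC y x') addrA subrK.
by apply: rpredD; apply: ideal_genMr.
Qed.

Lemma pi_quot_add x y :
  \pi_quot_ring (x + y) = \pi_quot_ring x + \pi_quot_ring y.
Proof. exact: (@Quotient.pi_add A ideal_gen x y). Qed.

Lemma quot_mulA : associative quot_mul.
Proof.
by move=> x y z; rewrite -[x]reprK -[y]reprK -[z]reprK -!pi_quot_mul mulrA.
Qed.

Lemma quot_mulC : commutative quot_mul.
Proof. by move=> x y; rewrite -[x]reprK -[y]reprK -!pi_quot_mul mulrC. Qed.

Lemma quot_mul1 : left_id quot_one quot_mul.
Proof. by move=> x; rewrite -[x]reprK -pi_quot_mul mul1r. Qed.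

Lemma quot_mulDl : left_distributive quot_mul +%R.
Proof.
move=> x y z; rewrite -[x]reprK -[y]reprK -[z]reprK.
by rewrite -pi_quot_add -!pi_quot_mul -pi_quot_add mulrDl.
Qed.

HB.instance Definition _ := GRing.Zmodule_isComPzRing.Build quot_ring
  quot_mulA quot_mulC quot_mul1 quot_mulDl.

End GeneratedIdeal.

Section Artinian.
Local Open Scope classical_set_scope.

Definition is_ideal (R : comPzRingType) (I : set R) : Prop :=
  [/\ I 0, forall x y, I x -> I y -> I (x + y) & forall a x, I x -> I (a * x)].

Definition artinian (R : comPzRingType) : Prop :=
  forall I : nat -> set R,
    (forall k, is_ideal (I k)) -> (forall k, I k.+1 `<=` I k) ->
    exists N, forall k, (N <= k)%N -> I k = I N.
End Artinian.

Section IndicatorSystems.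
Variable C : comNzRingType.

Definition common_zero (N s : nat) (f : 'I_s -> {mpoly C[N]})
  (v : 'I_N -> C) : Prop := forall i, (f i).@[v] = 0.

Definition tail_system (N s : nat) (f : 'I_s.+1 -> {mpoly C[N]}) :
  'I_s -> {mpoly C[N]} := fun j => f (lift ord0 j).

Definition nullstellensatz_certificate (N s : nat)
  (f beta : 'I_s -> {mpoly C[N]}) : Prop := \sum_i beta i * f i = 1.

Variables n p : nat.

(* In {mpoly C[n + p]} the first n variables are the indicator variables y_i
   and the last p variables are the x_j. *)
Definition yidx (i : 'I_n) : 'I_(n + p) := lshift p i.

Definition yvar (i : 'I_n) : {mpoly C[n + p]} := 'X_(yidx i).

Definition ymon (d : {ffun 'I_n -> bool}) : {mpoly C[n + p]} :=
  \prod_(i | d i) yvar i.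

Definition chi (I : {set 'I_n}) (i : 'I_n) : C := (i \in I)%:R.

Variables (s : nat) (f : 'I_s -> {mpoly C[n + p]}).

Definition has_solution_with (a : 'I_n -> C) : Prop :=
  exists2 v : 'I_(n + p) -> C,
    common_zero f v & forall i, v (yidx i) = a i.

Definition attained_indicators : set {ffun 'I_n -> bool} :=
  [set d : {ffun 'I_n -> bool} | has_solution_with (fun i => (d i)%:R)]%classic.

Definition subset_closed : Prop :=
  has_solution_with (fun=> 0) /\
  forall I : {set 'I_n}, has_solution_with (chi I) ->
    forall J : {set 'I_n}, J \subset I -> has_solution_with (chi J).

End IndicatorSystems.

(* Main.v *)
Require Import Defs.
From mathcomp Require Import all_boot all_order all_algebra.
From mathcomp Require Import boolp classical_sets functions cardinality reals.
From mathcomp Require constructive_ereal lebesgue_measure.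
From mathcomp Require Import complex.
From mathcomp Require Import mpoly.
From mathcomp Require Import ring.

(* On the finite family B of attained supports, f_1 takes the value |S| - m at
   S, which never vanishes; since B is closed under subsets, this forces every
   S in B to have fewer than m elements. The monomials y_S with S not in B lie
   in I = <f_2, ..., f_s>: the colon ideal (I : y_S) has no common zero, so it
   is trivial by the weak Nullstellensatz. Modulo I the inverse of f_1 is thus
   a combination of the y_S with S in B, and comparing coefficients in
   f_1 * beta_1 = 1 gives c_0 = -1/m and (m - r) c_r = r c_(r-1) for r = |S|,
   so that no coefficient vanishes. The weak Nullstellensatz itself is proved
   for an uncountable algebraically closed field by the countable-dimension
   argument. *)

Set Implicit Arguments.
Unset Strict Implicit.

Import GRing.Theory Num.Theory.
Local Open Scope ring_scope.

(** * Uncountability and linear dependence in bounded degree *)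

Lemma uncountable_fiber (T : choiceType) (D : T -> nat) :
  ~ countable [set: T]%classic -> exists d, infinite_set [set t | D t = d]%classic.
Proof.
move=> Tunc; apply: contrapT => /forallNP fibfin; apply: Tunc.
suff -> : ([set: T] = \bigcup_(d in [set: nat]) [set t | D t = d])%classic.
  apply: bigcup_countable => // d _; apply: finite_set_countable.
  by apply: contrapT; exact: fibfin.
by apply/seteqP; split => // t _; exists (D t).
Qed.

Lemma infinite_set_uniq_seq (T : choiceType) (E : set T) (k : nat) :
  infinite_set E ->
  exists l : seq T, [/\ uniq l, (k <= size l)%N & {in l, forall t, E t}].
Proof.
move=> /(@infinite_set_fset _ _ k)[B BE kB].
by exists (finmap.enum_fset B); split; [exact: finmap.fset_uniq| |move=> t /BE].
Qed.

(** A countable set has Lebesgue measure zero, while the unit interval has measure one. *)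
Lemma real_uncountable (R : realType) : ~ countable [set: R]%classic.
Proof.
move=> Rc.
have := @lebesgue_measure.countable_lebesgue_measure0 R [set` `[0, 1]%R]%classic.
rewrite lebesgue_measure.lebesgue_measure_itv/= constructive_ereal.lte_fin ltr01.
rewrite constructive_ereal.sube0.
move=> /(_ (sub_countable (subset_card_le (@subsetT _ _)) Rc)) [].
exact/eqP/oner_neq0.
Qed.

Lemma complex_uncountable (R : realType) : ~ countable [set: R[i]]%classic.
Proof.
move=> /countable_injP[h hinj]; apply: (@real_uncountable R); apply/countable_injP.
exists (fun x => h x%:C%C) => x y _ _ hxy.
by have /(congr1 (@complex.Re R)) := hinj _ _ (in_setT _) (in_setT _) hxy.
Qed.

(** The coefficient matrix has more rows than columns, hence a nonzero left kernel vector. As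
    [msize] is the degree plus one, [msize <= D] leaves only monomials of degree below [D]. *)
Lemma bounded_msize_dependent (F : fieldType) (N D k : nat)
    (g : 'I_k -> {mpoly F[N]}) :
  (forall i, msize (g i) <= D)%N -> (#|{: 'X_{1..N < D}}| < k)%N ->
  exists c : 'I_k -> F, (exists i, c i != 0) /\ \sum_i c i *: g i = 0.
Proof.
move=> gD ltk.
pose M : 'M[F]_(k, #|{: 'X_{1..N < D}}|) :=
  \matrix_(i, j) (g i)@_(enum_val j : 'X_{1..N < D}).
have /rowV0Pn[u /sub_kermxP uM u0] : kermx M != 0.
  rewrite kermx_eq0 /row_free; apply/eqP => rM.
  by have := rank_leq_col M; rewrite rM leqNgt ltk.
exists (u 0); split.
  have /rV0Pn[i ui] := u0; by exists i.
apply/mpolyP => mu; rewrite mcoeff0 raddf_sum/=.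
have [muD|muD] := ltnP (mdeg mu) D; last first.
  apply: big1 => i _; rewrite mcoeffZ.
  by rewrite (memN_msupp_eq0 (msize_mdeg_ge (leq_trans (gD i) muD))) mulr0.
have /matrixP/(_ 0 (enum_rank (BMultinom muD))) := uM.
rewrite !mxE => {2}<-; apply: eq_bigr => i _.
by rewrite mcoeffZ !mxE enum_rankK.
Qed.

(** * Ideals and the adjunction of an element *)

Section IdealTheory.
Variables (A : comPzRingType) (I : set A).
Hypothesis Iideal : is_ideal I.

Lemma is_idealN x : I x -> I (- x).
Proof. by case: Iideal => _ _ IM Ix; rewrite -mulN1r; exact: IM. Qed.

Lemma is_idealB x y : I x -> I y -> I (x - y).
Proof. by move=> Ix /is_idealN Iy; case: Iideal => _ ID _; exact: ID. Qed.

Lemma is_ideal_sum (T : Type) (r : seq T) (P : pred T) (F : T -> A) :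
  (forall i, P i -> I (F i)) -> I (\sum_(i <- r | P i) F i).
Proof. by case: Iideal => I0 ID _; exact: big_ind. Qed.

(** In this form, membership of 1 says directly that [x] is invertible modulo [I]. *)
Definition ideal_adjoin (x : A) : set A :=
  [set y | exists g, I (y - g * x)]%classic.

Lemma ideal_adjoin_is_ideal x : is_ideal (ideal_adjoin x).
Proof.
have [I0 ID IM] := Iideal; split.
- by exists 0; rewrite mul0r subr0.
- move=> y z [g Ig] [h Ih]; exists (g + h).
  by rewrite mulrDl opprD addrACA; exact: ID.
- by move=> a y [g Ig]; exists (a * g); rewrite -mulrA -mulrBr; exact: IM.
Qed.

Lemma ideal_adjoin_sub x y : I y -> ideal_adjoin x y.
Proof. by exists 0; rewrite mul0r subr0. Qed.

Lemma ideal_adjoin_mem x : ideal_adjoin x x.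
Proof. by have [I0 _ _] := Iideal; exists 1; rewrite mul1r subrr. Qed.

End IdealTheory.

(** * The weak Nullstellensatz over an uncountable algebraically closed field *)

Section Nullstellensatz.
Variables (C : closedFieldType) (N : nat).
Hypothesis Cunc : ~ countable [set: C]%classic.
Local Notation A := {mpoly C[N]}.

(* Otherwise uncountably many inverses [g a] exist, so for some degree bound
   more of them than the dimension are dependent; clearing denominators in
   [\sum_i c i / (x - t i) = 0] gives a nonzero polynomial in [x], hence a
   product of invertible factors [x - z], lying in [I]. *)
Lemma exists_noninvertible_shift (I : set A) (x : A) : is_ideal I -> ~ I 1 ->
  exists a : C, ~ ideal_adjoin I (x - a%:MP) 1.
Proof.
move=> Iid I1; apply: contrapT => /forallNP allinv; apply: I1.
have {allinv} /choice[g gP] : forall a : C, exists g, I (1 - g * (x - a%:MP)).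
  by move=> a; exact: contrapT (allinv a).
have [I0 ID IM] := Iid.
have [D] := uncountable_fiber (fun a => msize (g a)) Cunc.
move=> /(infinite_set_uniq_seq #|{: 'X_{1..N < D}}|.+1)[B [uB sB BD]].
pose t (i : 'I_(size B)) := nth 0 B i.
have tD i : msize (g (t i)) = D by apply: BD => /=; exact: mem_nth.
have [] := @bounded_msize_dependent C N D (size B) (fun i => g (t i)) _ sB.
  by move=> i; rewrite tD.
move=> c [[i0 ci0] gc].
pose q : {poly C} := \sum_i c i *: \prod_(j | j != i) ('X - (t j)%:P).
have evL (a : C) : horner_alg x ('X - a%:P) = x - a%:MP.
  by rewrite rmorphB/= horner_algX horner_algC -mul_mpolyC mulr1.
(* At [t i0] only the summand of index [i0] survives, because the [t i] are distinct. *)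
have q0 : q != 0.
  apply/eqP => /(congr1 (horner^~ (t i0))); rewrite horner0 /q horner_sum.
  rewrite (bigD1 i0)//= [X in _ + X]big1 ?addr0 => [|i ni]; last first.
    rewrite hornerZ horner_prod (bigD1 i0) 1?eq_sym//= hornerXsubC subrr.
    by rewrite mul0r mulr0.
  rewrite hornerZ horner_prod => /eqP; rewrite mulf_eq0 (negPf ci0)/=.
  rewrite prodf_seq_eq0 => /hasP[j _ /andP[nj]].
  rewrite !hornerE subr_eq0 nth_uniq// => /eqP/val_inj i0j.
  by rewrite i0j eqxx in nj.
have Iq : I (horner_alg x q).
  (* Since [\sum_i c i *: g (t i) = 0], the subtracted terms add up to zero; each summand becomes a
     multiple of [1 - g (t i) * (x - t i)], which lies in [I]. *)
  have -> : horner_alg x q =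
      \sum_i c i *: (\prod_(j | j != i) (x - (t j)%:MP)
         - g (t i) * \prod_j (x - (t j)%:MP)).
    rewrite (eq_bigr (fun i => c i *: \prod_(j | j != i) (x - (t j)%:MP) -
         (c i *: g (t i)) * \prod_j (x - (t j)%:MP))); last first.
      by move=> i _; rewrite scalerBr scalerAl.
    rewrite sumrB -mulr_suml gc mul0r subr0 /q rmorph_sum/=.
    apply: eq_bigr => i _; rewrite linearZ/= mulr_algl rmorph_prod/=.
    by congr (_ *: _); apply: eq_bigr => j _; exact: evL.
  apply: is_ideal_sum => // i _; rewrite -mul_mpolyC; apply: (IM).
  rewrite [X in g _ * X](bigD1 i)//= mulrA -{1}[\prod_(j | _) _]mul1r -mulrBl.
  by rewrite mulrC; apply: (IM).
have [r qE] := closed_field_poly_normal q.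
have cancel_roots (l : seq C) : I (\prod_(z <- l) (x - z%:MP)) -> I 1.
  elim: l => [|z l IHl]; first by rewrite big_nil.
  rewrite big_cons => Izl; apply: IHl.
  set w := \prod_(_ <- _) _ in Izl *.
  have -> : w = w * (1 - g z * (x - z%:MP)) + g z * ((x - z%:MP) * w).
    by rewrite mulrBr mulr1 mulrA (mulrC w) subrK.
  by apply: (ID); apply: (IM).
apply: (cancel_roots r).
have -> : \prod_(z <- r) (x - z%:MP) = (lead_coef q)^-1%:MP * horner_alg x q.
  rewrite {2}qE linearZ/= mulr_algl mul_mpolyC scalerA mulVf ?lead_coef_eq0// scale1r.
  by rewrite rmorph_prod/=; apply: eq_bigr => z _; rewrite evL.
exact: IM.
Qed.

(** Adjoining some ['X_i - v i] for one variable after another keeps the ideal proper. Modulo the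
    final ideal [J] every polynomial equals its value at [v], so an element of [I] not vanishing at
    [v] would put a nonzero constant into [J]. *)
Theorem weak_nullstellensatz (I : set A) : is_ideal I -> ~ I 1 ->
  exists v : 'I_N -> C, forall g, I g -> g.@[v] = 0.
Proof.
move=> Iid I1.
have [v [J [Jid J1 IJ Jv]]] : exists (v : 'I_N -> C) (J : set A),
    [/\ is_ideal J, ~ J 1, (I `<=` J)%classic &
        forall i, i \in enum 'I_N -> J ('X_i - (v i)%:MP)].
  elim: (enum 'I_N) => [|i l [v [J [Jid J1 IJ Jv]]]].
    by exists (fun=> 0), I; split.
  have [a Ja] := @exists_noninvertible_shift J 'X_i Jid J1.
  exists (fun j => if j == i then a else v j), (ideal_adjoin J ('X_i - a%:MP)).
  split => //; first exact: ideal_adjoin_is_ideal.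
    by move=> y /IJ; exact: ideal_adjoin_sub.
  move=> j; rewrite inE; case: eqVneq => [-> _|_ /=]; first exact: ideal_adjoin_mem.
  by move=> /Jv; exact: ideal_adjoin_sub.
have [J0 JD JM] := Jid.
exists v => g Ig; apply: contrapT => /eqP gv; apply: J1.
have Jev (h : A) : J (h - (h.@[v])%:MP).
  elim/mpolyind: h => [|c mu h _ _ Jh]; first by rewrite meval0 subr0.
  rewrite mevalD rmorphD/= opprD addrACA; apply: (JD) => //.
  rewrite mevalZ rmorphM/= -mul_mpolyC -mulrBr; apply: (JM).
  rewrite mpolyXE_id rmorph_prod/= rmorph_prod/=.
  apply: (big_ind2 (fun p q : A => J (p - q))); first by rewrite subrr.
    move=> p1 p2 q1 q2 J1 J2.
    have -> : p1 * q1 - p2 * q2 = q1 * (p1 - p2) + p2 * (q1 - q2).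
      by rewrite !mulrBr (mulrC q1) (mulrC q1) addrA subrK.
    by apply: (JD); apply: (JM).
  move=> i _; rewrite !rmorphXn/= mevalXU.
  elim: (mu i) => [|k IHk]; first by rewrite !expr0 subrr.
  rewrite !exprS.
  rewrite (_ : _ - _ = 'X_i ^+ k * ('X_i - (v i)%:MP)
      + (v i)%:MP * ('X_i ^+ k - (v i)%:MP ^+ k)).
    by apply: (JD); apply: (JM) => //; apply: Jv; rewrite mem_enum.
  by rewrite !mulrBr (mulrC ('X_i ^+ k)) (mulrC ('X_i ^+ k)) addrA subrK.
have : J (g.@[v])%:MP.
  by rewrite -[X in J X](subKr g); apply: is_idealB => //; exact: IJ.
move=> /(JM (g.@[v])^-1%:MP).
by rewrite -rmorphM/= mulVf.
Qed.
End Nullstellensatz.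

(** * Generated ideals and colon ideals *)

Lemma ideal_gen_is_ideal (A : comNzRingType) (s : nat) (f : 'I_s -> A) :
  is_ideal [set x | x \in ideal_gen f]%classic.
Proof.
split => [|x y fx fy|a x]; [exact: rpred0|exact: rpredD|exact: ideal_genMr].
Qed.

Lemma ideal_gen_mem (A : comNzRingType) (s : nat) (f : 'I_s -> A) j :
  f j \in ideal_gen f.
Proof.
apply/ideal_genP; exists (fun i => (i == j)%:R).
rewrite (bigD1 j)//= eqxx mul1r big1 ?addr0// => i /negPf ->.
by rewrite mul0r.
Qed.

Lemma colon_is_ideal (A : comPzRingType) (I : set A) (y : A) :
  is_ideal I -> is_ideal [set x | I (y * x)]%classic.
Proof.
move=> [I0 ID IM]; split => /=; first by rewrite mulr0.
  by move=> a b Ia Ib; rewrite mulrDr; exact: ID.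
by move=> a b Ib; rewrite mulrCA; exact: IM.
Qed.

(** * Indicator monomials and the Boolean equations *)

Section IndicatorMonomials.
Variables (C : fieldType) (n p : nat).
Local Notation A := {mpoly C[n + p]}.

Definition yprod (S : {set 'I_n}) : A := \prod_(i in S) yvar C p i.

Definition yexp (S : {set 'I_n}) : 'X_{1..n + p} :=
  (\sum_(i in S) U_(yidx p i))%MM.

Lemma yprodE S : yprod S = 'X_[yexp S].
Proof. by rewrite /yexp (big_morph (@mpolyX _ _) (@mpolyXD _ _) (mpolyX0 _ _)). Qed.

Lemma yexp_yidx S i : yexp S (yidx p i) = (i \in S).
Proof.
rewrite /yexp mnm_sumE; under eq_bigr do rewrite mnm1E (inj_eq (@lshift_inj _ _)).
have [iS|iS] := boolP (i \in S).
  by rewrite (bigD1 i)//= eqxx big1 ?addn0// => j /andP[_ /negPf ->].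
by rewrite big1// => j jS; case: eqVneq => // ji; rewrite -ji jS in iS.
Qed.

Lemma yexp_inj : injective yexp.
Proof.
move=> S T ST; apply/setP => i.
by have := yexp_yidx S i; rewrite ST yexp_yidx; do 2 case: (i \in _).
Qed.

Lemma ymonE (d : {ffun 'I_n -> bool}) : ymon C p d = yprod [set i | d i].
Proof. by rewrite /yprod; apply: eq_bigl => i; rewrite inE. Qed.

Lemma yprodM1 (S : {set 'I_n}) i : i \in S -> yprod S = yvar C p i * yprod (S :\ i).
Proof. by move=> iS; rewrite /yprod (big_setD1 i). Qed.

(** Distinct sets have distinct exponents, so no two terms merge or cancel. *)
Lemma mcoeff_sum_yprod (c : {set 'I_n} -> C) S :
  (\sum_T c T *: yprod T)@_(yexp S) = c S.
Proof.
rewrite raddf_sum/= (bigD1 S)//= big1 ?addr0 => [|T TS].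
  by rewrite mcoeffZ yprodE mcoeffX eqxx mulr1.
by rewrite mcoeffZ yprodE mcoeffX (inj_eq yexp_inj) (negPf TS) mulr0.
Qed.

Lemma msupp_sum_yprod (c : {set 'I_n} -> C) mu :
  mu \in msupp (\sum_T c T *: yprod T) <-> exists2 S, c S != 0 & mu = yexp S.
Proof.
split; last by move=> [S cS ->]; rewrite mcoeff_msupp mcoeff_sum_yprod.
rewrite mcoeff_msupp; have [[S ->]|noS] := pselect (exists S, mu = yexp S).
  by rewrite mcoeff_sum_yprod; exists S.
case/eqP; rewrite raddf_sum/=; apply: big1 => S _; rewrite mcoeffZ yprodE mcoeffX.
by case: eqVneq => [yS|_]; [case: noS; exists S|rewrite mulr0].
Qed.

Variables (s : nat) (F : 'I_s -> A).
Hypothesis boolean_eqs : forall i : 'I_n, exists j : 'I_s,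
  F j = yvar C p i ^+ 2 - yvar C p i.

(** The difference is the Boolean equation of [i] times the monomial of [S :\ i]. *)
Lemma yvar_yprod_ideal (S : {set 'I_n}) i : i \in S ->
  yvar C p i * yprod S - yprod S \in ideal_gen F.
Proof.
move=> iS; rewrite (yprodM1 iS) mulrA -mulrBl mulrC; apply: ideal_genMr.
by have [j <-] := boolean_eqs i; exact: ideal_gen_mem.
Qed.

Lemma common_zero_yvar (v : 'I_(n + p) -> C) i : common_zero F v ->
  v (yidx p i) = (v (yidx p i) == 1)%:R.
Proof.
move=> Fv; have [j Fj] := boolean_eqs i; have := Fv j.
rewrite Fj mevalB rmorphXn/= mevalXU => /eqP; rewrite expr2 -[X in _ - X]mulr1 -mulrBr.
rewrite mulf_eq0 subr_eq0 => /orP[] /eqP ->; last by rewrite eqxx.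
by rewrite eq_sym oner_eq0.
Qed.

Local Notation B S := (has_solution_with F (chi C S)).

Lemma attained_indicatorsE (d : {ffun 'I_n -> bool}) :
  attained_indicators F d <-> B [set i | d i].
Proof.
rewrite /attained_indicators/=.
suff -> : (fun i => (d i)%:R) = chi C [set i | d i] by [].
by apply/funext => i; rewrite /chi inE.
Qed.

End IndicatorMonomials.

(** * Monomials of unattained supports vanish in the quotient *)

Section AttainedMonomials.
Variables (C : closedFieldType) (n p s : nat) (F : 'I_s -> {mpoly C[n + p]}).
Hypothesis Cunc : ~ countable [set: C]%classic.
Hypothesis boolean_eqs : forall i : 'I_n, exists j : 'I_s,
  F j = yvar C p i ^+ 2 - yvar C p i.
Hypothesis closedF : subset_closed F.

(* The colon ideal of [yprod S] contains the equations together with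
   all [y_i - 1], [i \in S], so a zero of it extends [S]. *)
Lemma yprod_ideal (S : {set 'I_n}) :
  ~ has_solution_with F (chi C S) -> yprod C p S \in ideal_gen F.
Proof.
move=> nS; apply: contrapT => yS.
have Iid := colon_is_ideal (yprod C p S) (ideal_gen_is_ideal F).
have [|v vK] := weak_nullstellensatz Cunc Iid; first by rewrite /= mulr1.
have Fv : common_zero F v.
  by move=> j; apply: vK => /=; apply: ideal_genMr; exact: ideal_gen_mem.
(* [T] is the support of the zero [v]; it contains [S] but may be larger, and subset closure brings
   the solution back down to [S]. *)
apply: nS; pose T := [set i | v (yidx p i) == 1].
have [_ /(_ T) closedT] := closedF; apply: closedT.
  exists v => // i; rewrite /chi inE; exact: (common_zero_yvar boolean_eqs).
apply/fintype.subsetP => i iS; rewrite inE.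
have := vK (yvar C p i - 1); rewrite mevalB mevalXU meval1 => vi.
rewrite -subr_eq0 vi//=.
by rewrite mulrBr mulr1 mulrC; exact: yvar_yprod_ideal.
Qed.

End AttainedMonomials.

(** * The coefficients and the inverse of the linear form *)

Lemma exists_subset_card (T : finType) (S : {set T}) k : (k <= #|S|)%N ->
  exists2 U : {set T}, U \subset S & #|U| = k.
Proof.
move=> kS; exists [set x in take k (enum S)].
  by apply/fintype.subsetP => x; rewrite inE => /mem_take; rewrite mem_enum.
rewrite cardsE (card_uniqP _) ?take_uniq ?enum_uniq//.
by rewrite size_takel// -cardE.
Qed.

Section Certificate.
Variables (C : numClosedFieldType) (m : nat).

(* The [r]-th finite difference at [0] of [t |-> 1 / (t - m)]: by Moebius
   inversion over a subset closed family, the coefficient on sets of size [r]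
   of the multilinear function taking the value [1 / (#|S| - m)] at [S]. *)
Definition coef (r : nat) : C := - ((r`! * (m - r.+1)`!)%:R / (m`!)%:R).

Lemma coef_neq0 r : coef r != 0.
Proof.
rewrite oppr_eq0 mulf_eq0 invr_eq0 !pnatr_eq0 negb_or -!lt0n.
by rewrite muln_gt0 !fact_gt0.
Qed.

Lemma coef0 : (0 < m)%N -> coef 0 * m%:R = -1.
Proof.
rewrite /coef; case: m => // k _; rewrite mul1n subn1 factS natrM.
by rewrite /=; field; rewrite nat1r !pnatr_eq0 -lt0n fact_gt0.
Qed.

(** The bound makes [m - r.+2] a genuine difference. At [r.+1 = m] the first term would vanish and
    the second would not, which is why [attained_card] matters. *)
Lemma coefS r : (r.+1 < m)%N ->
  coef r.+1 * (r.+1%:R - m%:R) + r.+1%:R * coef r = 0.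
Proof.
move=> rm; rewrite /coef -(subnSK rm) !factS !natrM.
have -> : m%:R = (m - r.+2)%:R + r.+2%:R :> C by rewrite -natrD subnK.
by field; rewrite pnatr_eq0 -lt0n fact_gt0.
Qed.

Variables (n p s : nat) (F : 'I_s -> {mpoly C[n + p]}).
Hypothesis Cunc : ~ countable [set: C]%classic.
Hypothesis boolean_eqs : forall i : 'I_n, exists j : 'I_s,
  F j = yvar C p i ^+ 2 - yvar C p i.
Hypothesis closedF : subset_closed F.
Local Notation linear_form := (- m%:R + \sum_(i < n) yvar C p i).
Hypothesis infeasible : forall v, common_zero F v -> linear_form.@[v] != 0.

Local Notation B S := (has_solution_with F (chi C S)).

(** Otherwise an [m]-element subset of [S] is attained too, and there the linear form is zero. *)
Lemma attained_card S : B S -> (#|S| < m)%N.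
Proof.
move=> BS; rewrite ltnNge; apply/negP => /exists_subset_card[T TS Tm].
have [_ /(_ S BS T TS) [v /infeasible /eqP + vT]] := closedF; apply.
rewrite mevalD mevalN rmorph_nat raddf_sum/=.
under eq_bigr do rewrite mevalXU vT.
rewrite -natr_sum (_ : (\sum_i _)%N = m) ?addNr// -Tm -sum1_card [RHS]big_mkcond.
by apply: eq_bigr => i _; case: (i \in T).
Qed.

(** The value 0 off the attained sets makes the support exactly the attained family. *)
Definition beta_coef (S : {set 'I_n}) : C := if `[<B S>] then coef #|S| else 0.

Lemma beta_coef_neq0 S : beta_coef S != 0 <-> B S.
Proof.
rewrite /beta_coef; case: asboolP => BS; first by rewrite coef_neq0.
by rewrite eqxx.
Qed.

(** The pairs of [i] and a set [T] avoiding [i] are regrouped by the union [S = i |: T], where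
    [T = S :\ i]. *)
Lemma sum_setD1_yprod (c : {set 'I_n} -> C) :
  \sum_i \sum_(S : {set 'I_n} | i \notin S) c S *: (yvar C p i * yprod C p S) =
  \sum_(S : {set 'I_n}) (\sum_(i in S) c (S :\ i)) *: yprod C p S.
Proof.
under [RHS]eq_bigr do rewrite scaler_suml.
rewrite [RHS](exchange_big_dep xpredT)//=; apply: eq_bigr => i _.
rewrite (reindex_onto (fun S : {set 'I_n} => S :\ i)
  (fun S => i |: S))/=; last first.
  by move=> S iS; rewrite finset.setU1K.
apply: eq_big => [S|S].
  rewrite !inE eqxx/=; apply/eqP/idP => [<-|iS]; last by rewrite finset.setD1K.
  by rewrite finset.setU11.
by move=> /andP[_ /eqP <-]; rewrite -yprodM1 ?finset.setU11// finset.setU1K ?inE ?eqxx.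
Qed.

(** The left side is the coefficient at [S] of the linear form times the candidate inverse, reduced
    by the Boolean equations. Every [S :\ i] is attained, so only cardinalities enter: [coef0]
    settles the empty set and [coefS] the others. *)
Lemma beta_coef_recurrence S : (0 < m)%N -> B S ->
  beta_coef S * (#|S|%:R - m%:R) + \sum_(i in S) beta_coef (S :\ i) =
  (S == finset.set0)%:R.
Proof.
move=> m0 BS; have Bsub i : B (S :\ i).
  by have [_ /(_ S BS)] := closedF; apply; exact: subD1set.
rewrite (eq_bigr (fun=> coef #|S|.-1)) => [|i iS]; last first.
  by rewrite /beta_coef asboolT// (cardsD1 i S) iS.
rewrite /beta_coef asboolT// sumr_const -cards_eq0.
have := attained_card BS; case: #|S| => [|r] rm /=.
  by rewrite sub0r mulrN coef0// opprK mulr0n addr0.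
by rewrite -[X in _ + X]mulr_natl coefS.
Qed.

Lemma linear_form_beta : (0 < m)%N ->
  linear_form * (\sum_S beta_coef S *: yprod C p S) - 1 \in ideal_gen F.
Proof.
move=> m0; set beta := \sum_S beta_coef S *: _.
(* For [i] in [S], the product of [y_i] and [y_S] is replaced by [y_S], the error going to the first
   sum; for [i] outside [S] it contributes to the coefficient at [i |: S]. *)
have -> : linear_form * beta - 1 =
    \sum_S beta_coef S *: \sum_(i in S) (yvar C p i * yprod C p S - yprod C p S)
    + \sum_S (beta_coef S * (#|S|%:R - m%:R) + \sum_(i in S) beta_coef (S :\ i)
        - (S == finset.set0)%:R) *: yprod C p S.
  under [X in _ = _ + X]eq_bigr do rewrite scalerBl scalerDl mulrBr scalerBl.
  rewrite !(sumrB, big_split)/= -sum_setD1_yprod.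
  set sum_m := \sum_S (beta_coef S * m%:R) *: _.
  set sum_card := \sum_S (beta_coef S * #|S|%:R) *: _.
  set sum_notin := \sum_i \sum_(S : {set 'I_n} | i \notin S) _.
  have -> : \sum_(S : {set 'I_n}) (S == finset.set0)%:R *: yprod C p S = 1.
    rewrite (bigD1 finset.set0)//= eqxx scale1r /yprod big_set0 big1 ?addr0//.
    by move=> S /negPf ->; rewrite scale0r.
  have -> : \sum_S beta_coef S *: \sum_(i in S)
      (yvar C p i * yprod C p S - yprod C p S) =
      \sum_(S : {set 'I_n}) \sum_(i in S) beta_coef S *: (yvar C p i * yprod C p S)
      - sum_card.
    rewrite -sumrB; apply: eq_bigr => S _.
    by rewrite sumrB sumr_const scalerBr scaler_sumr -scaler_nat scalerA.
  have sum_mE : sum_m = m%:R * beta.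
    rewrite mulr_sumr; apply: eq_bigr => S _.
    by rewrite mulr_natl -scaler_nat scalerA mulrC.
  have E : (\sum_(i < n) yvar C p i) * beta =
      \sum_(S : {set 'I_n}) \sum_(i in S) beta_coef S *: (yvar C p i * yprod C p S)
      + sum_notin.
    rewrite mulr_suml (exchange_big_dep xpredT)//= -big_split/=.
    apply: eq_bigr => i _; rewrite mulr_sumr (bigID (fun S : {set 'I_n} => i \in S))/=.
    by congr (_ + _); apply: eq_bigr => S _; rewrite scalerAr.
  rewrite sum_mE mulrDl E; ring.
apply: rpredD.
  apply: rpred_sum => S _; rewrite -mul_mpolyC; apply: ideal_genMr.
  by apply: rpred_sum => i; exact: yvar_yprod_ideal.
(* At an attained [S] the coefficient vanishes; at any other the monomial itself lies in the
   ideal. *)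
apply: rpred_sum => S _; have [BS|nBS] := pselect (B S).
  by rewrite beta_coef_recurrence// subrr scale0r rpred0.
by rewrite -mul_mpolyC; apply: ideal_genMr; exact: yprod_ideal.
Qed.
End Certificate.

(** * Assembling the certificate and reading off its support *)

Unset Implicit Arguments.
Set Strict Implicit.

Theorem theorem3p5 (R : realType) (n p s m : nat)
    (f : 'I_s.+1 -> {mpoly R[i][n + p]}) :
  m <> 0%N ->
  f ord0 = - m%:R + \sum_(i < n) yvar R[i] p i ->
  (forall i : 'I_n, exists j : 'I_s,
      tail_system f j = yvar R[i] p i ^+ 2 - yvar R[i] p i) ->
  (~ exists v : 'I_(n + p) -> R[i], common_zero f v) ->
  artinian (quot_ring (tail_system f)) ->
  subset_closed (tail_system f) ->
  exists2 beta : 'I_s.+1 -> {mpoly R[i][n + p]},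
    nullstellensatz_certificate f beta &
    forall mu : 'X_{1..n + p},
      mu \in msupp (beta ord0) <->
      exists2 b, attained_indicators (tail_system f) b & 'X_[mu] = ymon R[i] p b.
Proof.
move=> /eqP; rewrite -lt0n => m0 f0 boolf nozero _ closedf.
have infeasible v : common_zero (tail_system f) v ->
    (- m%:R + \sum_(i < n) yvar R[i] p i).@[v] != 0.
  move=> Fv; apply/eqP => f0v; apply: nozero; exists v => j.
  by case: (unliftP ord0 j) => [k|] ->; [exact: Fv|rewrite f0].
have /ideal_genP[g gE] :=
  linear_form_beta (@complex_uncountable R) boolf closedf infeasible m0.
set beta0 := \sum_S beta_coef _ _ S *: _ in gE.
(* The cofactors [g] express [f ord0 * beta0 - 1] in the remaining equations, hence the sign. *)
exists (fun j => if unlift ord0 j is Some k then - g k else beta0).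
  rewrite /nullstellensatz_certificate big_ord_recl unlift_none f0 mulrC.
  rewrite (eq_bigr (fun k => - (g k * tail_system f k))) => [|k _]; last first.
    by rewrite liftK mulNr.
  by rewrite sumrN -[\sum_(i < s) _]gE opprB addrC subrK.
move=> mu; rewrite unlift_none msupp_sum_yprod; split.
  move=> [S /beta_coef_neq0 BS ->]; exists [ffun i => i \in S].
    apply/attained_indicatorsE; congr (has_solution_with _ (chi _ _)) : BS.
    by apply/setP => i; rewrite inE ffunE.
  rewrite ymonE -yprodE; congr yprod.
  by apply/setP => i; rewrite inE ffunE.
move=> [b /attained_indicatorsE Bb]; rewrite ymonE yprodE => Xmu.
exists [set i | b i]; first exact/beta_coef_neq0.
have := congr1 (fun h => h@_mu) Xmu; rewrite !mcoeffX eqxx.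
by case: eqVneq => [->//|_ /eqP]; rewrite oner_eq0.
Qed.
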